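(* Let $p$ be a prime, $F$ a field of characteristic $p$, and $d,s,t,m\ge 1$ integers. For $1\le i\le s$ and $1\le j\le m$ let $P_{ij}\in\mathbb{Z}[x_1,\dots,x_t]$, let $b_{ij0},\dots,b_{ijt}\in M_d(F)$ and $a_{ij1},\dots,a_{ijt}\in M_d(F)$. Consider the system of exponential Diophantine equations $$\sum_{i=1}^{s} P_{ij}(n_1,\dots,n_t)\, b_{ij0}a_{ij1}^{n_1}b_{ij1}a_{ij2}^{n_2}b_{ij2}\cdots a_{ijt}^{n_t}b_{ijt}=0,\qquad j=1,\dots,m,$$ in unknowns $n_1,\dots,n_t\in\mathbb{N}$. Then the set of words corresponding to the solutions of this system is a regular language over the alphabet $\{0,1,\dots,p-1\}^t$ (which has $p^t$ letters). In other words, there is a finite oriented graph whose arrows are marked by letters of $\{0,1,\dots,p-1\}^t$, with one vertex declared initial and some vertices declared final, such that assigning to each solution its corresponding word gives a one-to-one correspondence between the solutions of the system and the words which may be read along paths of arrows (of arbitrary length, passing through any vertex arbitrarily many times) from the initial vertex to a final vertex.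
   Context: $\mathbb{N}$ denotes the non-negative integers. $M_d(F)$ is the ring of $d\times d$ matrices over $F$, and $a^0$ is the identity matrix. The integers $P_{ij}(n_1,\dots,n_t)$ act on $M_d(F)$ through $\mathbb{Z}\to F$. Word corresponding to a tuple: for $(n_1,\dots,n_t)\in\mathbb{N}^t$ let $k\ge 0$ be the least integer with $n_i<p^{k+1}$ for all $i$, and write $n_i=\sum_{l=0}^{k} n_i^{l}p^l$ with $n_i^{l}\in\{0,\dots,p-1\}$. The word corresponding to $(n_1,\dots,n_t)$ is the word $\langle n_1^k,\dots,n_t^k\rangle\cdots\langle n_1^0,\dots,n_t^0\rangle$ over the alphabet $\{0,\dots,p-1\}^t$. Words are written and read from right to left, i.e. the least significant letter $\langle n_1^0,\dots,n_t^0\rangle$ is read first. A regular language is a set of words that can be read along paths from the initial vertex to a final vertex of a finite automaton, i.e. of a finite oriented graph with one initial vertex, some final vertices, and edges marked by letters of a finite alphabet. *)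

(* Defs.v *)
From mathcomp Require Import all_boot all_order all_algebra.
From mathcomp Require Import mpoly.

Set Implicit Arguments.
Unset Strict Implicit.
Unset Printing Implicit Defensive.

Import GRing.Theory.
Local Open Scope ring_scope.

Section Automata.

Variable S : finType.

Record automaton := Automaton {
  vertex  : finType;
  arrows  : {set vertex * S * vertex};
  initial : vertex;
  final   : {set vertex}
}.

Fixpoint path_labels (A : automaton) (x : vertex A) (u : seq S) (y : vertex A)
    : Prop :=
  if u is c :: u' then
    exists2 z, (x, c, z) \in arrows A & path_labels z u' y
  else x = y.

(* Words are written from left to right in the list, but read from right to
   left: the last letter of [w] labels the arrow leaving the initial vertex. *)
Definition readable (A : automaton) (w : seq S) : Prop :=
  exists2 y, y \in final A & path_labels (initial A) (rev w) y.

Definition regular (L : seq S -> Prop) : Prop :=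
  exists A : automaton, forall w, L w <-> readable A w.

End Automata.

Notation letter p t := {ffun 'I_t -> 'I_p}.

Section Words.

Variables (p : nat) (p_pr : prime p) (t : nat).

Implicit Type n : {ffun 'I_t -> nat}.

Lemma top_digit_exists n : exists k, [forall i, n i < p ^ k.+1]%N.
Proof.
exists (\max_i n i); apply/forallP => i.
apply: leq_ltn_trans (leq_bigmax i) _.
apply: ltn_trans (ltnSn _) (ltn_expl _ (prime_gt1 p_pr)).
Qed.

Definition top_digit n : nat := ex_minn (top_digit_exists n).

Definition digit (a l : nat) : 'I_p :=
  Ordinal (ltn_pmod (a %/ p ^ l) (prime_gt0 p_pr)).

Definition letter_at n (l : nat) : letter p t := [ffun i => digit (n i) l].

(* Most significant letter first. *)
Definition word_of n : seq (letter p t) :=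
  [seq letter_at n l | l <- rev (iota 0 (top_digit n).+1)].

End Words.

Section System.

Variables (F : fieldType) (d s t m : nat).
Variable P : 'I_s -> 'I_m -> {mpoly int[t]}.
Variable b : 'I_s -> 'I_m -> 'I_t.+1 -> 'M[F]_d.
Variable a : 'I_s -> 'I_m -> 'I_t -> 'M[F]_d.

Implicit Type n : {ffun 'I_t -> nat}.

(* [b i j] has t + 1 entries, indexed from 0, whereas the t entries of [a i j]
   and the unknowns are shifted to start at 0; the factor paired with
   [a i j k ^+ n k] is thus [b i j (lift ord0 k)], of index k + 1. *)
Definition exp_monomial (i : 'I_s) (j : 'I_m) n : 'M[F]_d :=
  b i j ord0 * \prod_(k < t) (a i j k ^+ n k * b i j (lift ord0 k)).

Definition poly_value (i : 'I_s) (j : 'I_m) n : int :=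
  (P i j).@[fun k => (n k)%:Z].

Definition solution n : Prop :=
  forall j : 'I_m,
    \sum_(i < s) (poly_value i j n)%:~R *: exp_monomial i j n = 0.

End System.

(* Main.v *)
Require Import Defs.
From Stdlib Require Import Classical.
From mathcomp Require Import all_boot all_order all_algebra.
From mathcomp Require Import mpoly.

Set Implicit Arguments.
Unset Strict Implicit.
Unset Printing Implicit Defensive.

Import GRing.Theory.
Local Open Scope ring_scope.

(** The solution set is regular because reading the least significant digit
    turns each vanishing condition into finitely many conditions of the same
    kind, taken from one finite stock.

    Let chi be the product of the characteristic polynomials of all the
    matrices [a i j k], and let rho(n, m) be the coefficient of X^m in X^n
    modulo chi. Raising X^n = \sum_m rho(n, m) X^m to the power p gives, modulo
    chi, X^(p n + r) = \sum_m rho(n, m)^p X^(p m + r)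
    ([dvdp_frobenius]). Evaluated at a matrix killed by chi, this
    expresses a^(p n + r) through the p-th powers of the rho(n, m), the other
    factors depending on r only; its coefficients give the same kind of
    relation for rho itself. Taking products over the unknowns
    ([tensor_coef]), and observing that the values of the polynomials P in F
    depend only on the last digit, each scalar equation at p n + r becomes
    \sum_m rho(n)_m^p W_m = 0, where W depends on the digits r and not on n
    ([solution_push]).

    It remains to remove the p-th power. All scalars involved lie in a
    subring A of F generated by finitely many elements c_x. A polynomial of
    degree at most D in the c_x is \sum_j c^j y_j^p, where the exponents in j
    are less than p and y_j has degree at most D / p ([bounded_frobenius]).
    Choose among the c^j a maximal family which is linearly independent over
    the p-th powers of A; up to a common factor h^p the other c^j are
    combinations of it ([frobenius_basis]). Comparing coefficients in that
    family, an equation \sum_m x_m^p u_m = 0 with u of degree at most D is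
    equivalent to finitely many equations \sum_m x_m z_m = 0 with z of degree
    at most D / p + N, where N does not depend on D ([frobenius_descent]).
    For D = 2 N + 1 the degree does not grow, even after multiplication by
    the matrix of one digit step, and since F has characteristic p there are
    only finitely many vectors z of bounded degree
    ([finite_frobenius_closure]).

    So there is a finite family of conditions on words such that each
    condition on a word extended by one digit is a conjunction of conditions
    of the family on the word itself. The powerset construction makes an
    automaton out of it ([universal_regular]). The condition of being the word
    of some tuple, without superfluous leading zero letters, is handled in the
    same way ([reduced_rcons]). *)

(** * Regularity from a finite family of conditions *)

(** The state reached after reading some letters is the set of conditions that
    the unread part of the word still has to satisfy. *)
Lemma universal_regular (S Q : finType) (L : Q -> seq S -> Prop)
    (accept : pred Q) :
    (forall q, L q [::] <-> accept q) ->
    (forall q c, exists X : {set Q},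
       forall w, L q (rcons w c) <-> forall q', q' \in X -> L q' w) ->
  forall q0, regular (L q0).
Proof.
move=> L_nil L_rcons q0.
have {L_rcons} [next nextP] : exists next : Q * S -> {set Q}, forall x w,
    L x.1 (rcons w x.2) <-> forall q', q' \in next x -> L q' w.
  apply: (@fin_all_exists _ (fun=> {set Q}) (fun x X => forall w,
    L x.1 (rcons w x.2) <-> forall q', q' \in X -> L q' w)) => -[q c].
  exact: L_rcons.
pose step (X : {set Q}) c := \bigcup_(q in X) next (q, c).
pose accepting := [set X : {set Q} | [forall q in X, accept q]].
pose A := @Automaton S {set Q}
  [set x | x.2 == step x.1.1 x.1.2] [set q0] accepting.
have runE u : forall X Y, path_labels (A := A) X u Y <-> Y = foldl step X u.
  elim: u => [|c u IHu] X Y /=; first by split.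
  split=> [[Z]|->]; first by rewrite inE /= => /eqP-> /IHu.
  by exists (step X c); [rewrite inE | apply/IHu].
have LE w (X : {set Q}) :
    (forall q, q \in X -> L q w) <-> foldl step X (rev w) \in accepting.
  elim/last_ind: w X => [|w c IHw] X.
    rewrite /= inE; split=> [LX|/forall_inP LX q /LX /L_nil //].
    by apply/forall_inP => q /LX /L_nil.
  rewrite rev_rcons /= -IHw; split=> [LX q /bigcupP[q' /LX Lq' qq']|LX q qX].
    exact: (nextP (q', c) w).1 Lq' q qq'.
  by apply/(nextP (q, c)) => q' q'X; apply: LX; apply/bigcupP; exists q.
exists A => w; split=> [Lw|[Y finY /runE defY]].
  exists (foldl step [set q0] (rev w)); last exact/runE.
  by apply/LE => q /set1P->.
by move: finY; rewrite defY => /LE; apply; rewrite set11.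
Qed.

(** * Elements of bounded degree in a finitely generated subring *)

Lemma exprp_sum (R : comNzRingType) (p : nat) (charR : p \in [pchar R])
    (I : Type) (r : seq I) (P : pred I) (f : I -> R) :
  (\sum_(i <- r | P i) f i) ^+ p = \sum_(i <- r | P i) f i ^+ p.
Proof.
rewrite -(pFrobenius_autE charR) rmorph_sum.
by apply: eq_bigr => i _; rewrite /= pFrobenius_autE.
Qed.

Lemma expr0p (R : comNzRingType) (p : nat) (charR : p \in [pchar R]) :
  0 ^+ p = 0 :> R.
Proof. by rewrite -(pFrobenius_autE charR) rmorph0. Qed.

Section Bounded.

Variables (F : fieldType) (p : nat) (charF : p \in [pchar F]).
Variables (X : finType) (c : X -> F).

Let p_gt0 : (0 < p)%N := prime_gt0 (pcharf_prime charF).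

Definition monomial (e : X -> nat) : F := \prod_x c x ^+ e x.

(** The elements that are polynomials in the [c x] with integer coefficients,
    of degree at most [D] in each variable. *)
Inductive bounded (D : nat) : F -> Prop :=
| bounded0 : bounded D 0
| boundedD e u : (forall x, e x <= D)%N -> bounded D u ->
    bounded D (monomial e + u).

Definition in_subring u := exists D, bounded D u.

Lemma bounded_monomial D e : (forall x, e x <= D)%N -> bounded D (monomial e).
Proof. by move=> le_e; rewrite -[monomial e]addr0; do !constructor. Qed.

Lemma bounded_add D u v : bounded D u -> bounded D v -> bounded D (u + v).
Proof.
move=> bu bv; elim: bu => [|e w le_e _ IH]; first by rewrite add0r.
by rewrite -addrA; constructor.
Qed.

Lemma bounded_sum D (I : Type) (r : seq I) (P : pred I) (f : I -> F) :
  (forall i, P i -> bounded D (f i)) -> bounded D (\sum_(i <- r | P i) f i).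
Proof. by move=> bf; apply: big_ind; [constructor | apply: bounded_add |]. Qed.

(** In characteristic p the opposite is a multiple with a natural number as
    coefficient, so that sums of monomials suffice. *)
Lemma bounded_opp D u : bounded D u -> bounded D (- u).
Proof.
move=> bu; have ->: - u = u *+ p.-1.
  by apply/eqP; rewrite eq_sym -addr_eq0 -mulrSr prednK // mulrn_pchar.
by elim: p.-1 => [|k IHk]; [constructor | rewrite mulrS; apply: bounded_add].
Qed.

Lemma bounded_le D D' u : (D <= D')%N -> bounded D u -> bounded D' u.
Proof.
move=> leD; elim=> [|e v le_e _ bv]; constructor=> // x.
exact: leq_trans (le_e x) leD.
Qed.

Lemma bounded_mul D D' u v :
  bounded D u -> bounded D' v -> bounded (D + D') (u * v).
Proof.
move=> bu bv; elim: bu => [|e u' le_e _ IH].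
  by rewrite mul0r; constructor.
rewrite mulrDl; apply: bounded_add IH.
elim: bv => [|e' v' le_e' _ IH]; first by rewrite mulr0; constructor.
rewrite mulrDr; apply: bounded_add IH.
have ->: monomial e * monomial e' = monomial (fun x => e x + e' x)%N.
  by rewrite -big_split; apply: eq_bigr => x _; rewrite exprD.
by apply: bounded_monomial => x; apply: leq_add.
Qed.

Lemma bounded1 : bounded 0 1.
Proof.
have ->: 1 = monomial (fun=> 0%N) by rewrite /monomial big1.
exact: bounded_monomial.
Qed.

Lemma bounded_exp D u k : bounded D u -> bounded (k * D) (u ^+ k).
Proof.
move=> bu; elim: k => [|k IHk]; first exact: bounded1.
by rewrite exprS mulSn; apply: bounded_mul.
Qed.

Lemma bounded_generator x : bounded 1 (c x).
Proof.
have ->: c x = monomial (fun y => y == x).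
  rewrite /monomial (bigD1 x) //= eqxx big1 ?mulr1 // => y.
  by move/negPf->; rewrite expr0.
by apply: bounded_monomial => y; case: (y == x).
Qed.

(** The coefficients matter only modulo p, and there are finitely many
    monomials. *)
Lemma bounded_finite D : exists s : seq F, forall u, u \in s <-> bounded D u.
Proof.
pose E := {ffun X -> 'I_D.+1}.
pose comb (k : E -> nat) := \sum_(e : E) monomial (fun x => e x) *+ k e.
have combE u : bounded D u -> exists k, u = comb k.
  elim=> [|e v le_e _ [k ->]].
    by exists (fun=> 0)%N; rewrite /comb big1.
  pose e0 : E := [ffun x => Ordinal (le_e x : e x < D.+1)%N].
  exists (fun e => (e == e0) + k e)%N; rewrite /comb.
  under [RHS]eq_bigr => i _ do rewrite mulrnDr.
  rewrite big_split /= [X in _ = X + _](bigD1 e0) //= eqxx.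
  rewrite [in X in _ = X + _]big1 => [|i /negPf->] //.
  by rewrite addr0; congr (_ + _); apply: eq_bigr => x _; rewrite ffunE.
pose reduced (k : {ffun E -> 'I_p}) := comb (fun e => k e).
exists (codom reduced) => u; split=> [/codomP[k ->]|/combE[k ->]].
  apply: bounded_sum => e _.
  elim: (k e : nat) => [|n IHn]; first by constructor.
  by rewrite mulrS; constructor=> // x; rewrite -ltnS.
apply/codomP.
exists [ffun e => Ordinal (ltn_pmod (k e) p_gt0)].
apply: eq_bigr => e _; rewrite ffunE /= [in LHS](divn_eq (k e) p).
by rewrite mulrnDr mulrnA mulrn_pchar // add0r.
Qed.

(** Euclidean division of each exponent by p, followed by additivity of the
    Frobenius to collect the monomials with the same remainder. *)
Lemma bounded_frobenius D u : bounded D u ->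
  exists2 y : {ffun X -> 'I_p} -> F, forall j, bounded (D %/ p) (y j) &
    u = \sum_(j : {ffun X -> 'I_p}) monomial (fun x => j x) * y j ^+ p.
Proof.
elim=> [|e v le_e _ [y by_ ->]].
  exists (fun=> 0) => [j|]; first by constructor.
  by rewrite big1 // => j _; rewrite (expr0p charF) mulr0.
pose j0 : {ffun X -> 'I_p} := [ffun x => Ordinal (ltn_pmod (e x) p_gt0)].
pose q := monomial (fun x => e x %/ p)%N.
have bq : bounded (D %/ p) q by apply: bounded_monomial => x; apply: leq_div2r.
exists (fun j => (if j == j0 then q else 0) + y j) => [j|].
  by apply: bounded_add (by_ j); case: ifP => _; [|constructor].
under [RHS]eq_bigr => j _ do
  rewrite -(pFrobenius_autE charF) rmorphD /= !(pFrobenius_autE charF) mulrDr.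
rewrite big_split /= [X in _ = X + _](bigD1 j0) //= eqxx.
rewrite [in X in _ = X + _]big1 => [|j /negPf->]; last first.
  by rewrite (expr0p charF) mulr0.
rewrite addr0 -prodrXl -big_split; congr (_ + _); apply: eq_bigr => x _ /=.
by rewrite ffunE /= -exprM -exprD addnC -divn_eq.
Qed.

Lemma in_subring_family (I : finType) (f : I -> F) :
  (forall i, in_subring (f i)) -> exists D, forall i, bounded D (f i).
Proof.
move=> /fin_all_exists[D bD]; exists (\max_i D i) => i.
exact: bounded_le (leq_bigmax i) (bD i).
Qed.

End Bounded.

(** * Linear independence over p-th powers *)

Section FrobeniusIndependence.

Variables (F : fieldType) (p : nat) (charF : p \in [pchar F]).
Variable A : F -> Prop.
Hypotheses (A0 : A 0) (A1 : A 1) (AN : forall u, A u -> A (- u)).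
Hypothesis AM : forall u v, A u -> A v -> A (u * v).

(** A maximal subfamily of [f] that is linearly independent over the p-th
    powers of the subring [A]. Working in [A] rather than in its fraction
    field, the other members of [f] are combinations of the subfamily only
    after multiplication by [h ^+ p], but then every coefficient in sight
    stays in [A]. *)
Lemma frobenius_basis (J : finType) (f : J -> F) :
  exists (E : {set J}) (h : F) (nu : J -> J -> F),
  [/\ A h /\ h != 0,
      forall j l, A (nu j l),
      forall j, h ^+ p * f j = \sum_(l in E) f l * nu j l ^+ p &
      forall z : J -> F, (forall l, A (z l)) ->
        \sum_(l in E) f l * z l ^+ p = 0 -> forall l, l \in E -> z l = 0].
Proof.
suff [E [h [nu [Ah Anu span indep]]]] :
    exists (E : {set J}) (h : F) (nu : J -> J -> F),
  [/\ A h /\ h != 0,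
      forall j l, A (nu j l),
      {in enum J, forall j, h ^+ p * f j = \sum_(l in E) f l * nu j l ^+ p} &
      forall z : J -> F, (forall l, A (z l)) ->
        \sum_(l in E) f l * z l ^+ p = 0 -> forall l, l \in E -> z l = 0].
  by exists E, h, nu; split=> // j; apply: span; rewrite mem_enum.
elim: (enum J) => [|j s [E [h [nu [[Ah h0] Anu span indep]]]]].
  exists set0, 1, (fun _ _ => 0); split=> //; first by rewrite oner_eq0.
  by move=> z _ _ l; rewrite inE.
have [indep_j|] := classic (forall z : J -> F, (forall l, A (z l)) ->
  \sum_(l in j |: E) f l * z l ^+ p = 0 -> forall l, l \in j |: E -> z l = 0).
  (* If [j |: E] is independent it replaces [E], with [h ^+ p * f j] written
     as [f j * h ^+ p]. *)
  have [jE|jE] := boolP (j \in E).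
    exists E, h,
      (fun i l => if i == j then (if l == j then h else 0) else nu i l).
    split=> // [i l|i]; first by do 2?case: ifP.
    rewrite inE; case: eqP => [-> _|_ /= /span //].
    rewrite (bigD1 j) //= eqxx big1 => [|l /andP[_ /negPf->]].
      by rewrite addr0 mulrC.
    by rewrite (expr0p charF) mulr0.
  exists (j |: E), h, (fun i l => if i == j then (if l == j then h else 0)
                       else if l == j then 0 else nu i l).
  split=> // [i l|i]; first by do 2?case: ifP.
  rewrite big_setU1 //= inE eqxx; case: eqP => [-> _|_ /= /span->].
    rewrite big1 => [|l lE]; first by rewrite addr0 mulrC.
    by case: eqP lE jE => [->->|] //; rewrite (expr0p charF) mulr0.
  rewrite (expr0p charF) mulr0 add0r; apply: eq_bigr => l lE.
  by case: eqP lE jE => [->->|].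
(* A nontrivial relation on [j |: E] involves [f j], since [E] is independent;
   solving it for [f j] multiplies the denominator by [z j]. *)
move=> /not_all_ex_not[z nz]; have {nz} [Az nz] := imply_to_and _ _ nz.
have {nz} [rel /not_all_ex_not[l0 nz]] := imply_to_and _ _ nz.
have {nz} [l0E /eqP zl0] := imply_to_and _ _ nz.
have jE : j \notin E.
  apply: contraNN zl0 => jE; move: rel l0E.
  by rewrite (setUidPr _) ?sub1set // => rel l0E; apply/eqP/(indep z).
rewrite big_setU1 //= in rel.
have zj0 : z j != 0.
  apply: contraNN zl0 => /eqP zj; case/setU1P: l0E => [->|l0E]; first exact/eqP.
  move: rel; rewrite zj (expr0p charF) mulr0 add0r => rel.
  exact/eqP/(indep z).
exists E, (h * z j), (fun i l => if i == j then - (h * z l) else nu i l * z j).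
split; [by split; [apply: AM | rewrite mulf_neq0] | | | exact: indep].
  by move=> i l; case: ifP => _; [apply/AN/AM | apply: AM].
move=> i; rewrite inE; case: eqP => [-> _|_ /= /span spi].
  have /eqP := rel; rewrite addr_eq0 mulrC => /eqP zf.
  rewrite exprMn -mulrA zf mulrN mulr_sumr -sumrN; apply: eq_bigr => l _.
  rewrite -[(- _) ^+ p](pFrobenius_autE charF) rmorphN /= pFrobenius_autE.
  by rewrite exprMn mulrN mulrCA.
rewrite exprMn mulrAC spi mulr_suml; apply: eq_bigr => l _.
by rewrite exprMn mulrA.
Qed.

End FrobeniusIndependence.

(** * Removing the p-th powers from an equation *)

Section Descent.

Variables (F : fieldType) (p : nat) (charF : p \in [pchar F]).
Variables (X : finType) (c : X -> F).

(** Expand each [u m] over the monomials with exponents less than p, then over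
    the independent subfamily of these monomials. The sum multiplied by
    [h ^+ p] becomes a combination of that subfamily with p-th powers as
    coefficients, so it vanishes only if they all do. The degree [N] of the
    change of family is independent of [D], which is what makes iteration
    possible. *)
Lemma frobenius_descent : exists N, forall D (B : finType) (u : B -> F),
  (forall m, bounded c D (u m)) ->
  exists z : {ffun X -> 'I_p} -> B -> F,
    (forall l m, bounded c (D %/ p + N) (z l m)) /\
    forall x : B -> F, (forall m, in_subring c (x m)) ->
      (\sum_m x m ^+ p * u m = 0 <-> forall l, \sum_m x m * z l m = 0).
Proof.
pose f (j : {ffun X -> 'I_p}) := monomial c (fun x => j x).
have poly0 : in_subring c 0 by exists 0%N; constructor.
have poly1 : in_subring c 1 by exists 0%N; apply: bounded1.
have polyN u : in_subring c u -> in_subring c (- u).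
  by move=> [D bu]; exists D; exact: (bounded_opp charF bu).
have polyM u v : in_subring c u -> in_subring c v -> in_subring c (u * v).
  by move=> [D bu] [D' bv]; exists (D + D')%N; apply: bounded_mul.
have [E [h [nu [[_ h0] polynu span indep]]]] :=
  frobenius_basis charF poly0 poly1 polyN polyM f.
have [N bnu] : exists N, forall jl : _ * _, bounded c N (nu jl.1 jl.2).
  by apply: in_subring_family => -[j l]; apply: polynu.
exists N => D B u bu.
have [y yP] := @fin_all_exists _ (fun=> {ffun X -> 'I_p} -> F) (fun m y =>
  (forall j, bounded c (D %/ p) (y j)) /\ u m = \sum_j f j * y j ^+ p)
  (fun m => let: ex_intro2 y by_ uy := bounded_frobenius charF (bu m) in
            ex_intro _ y (conj by_ uy)).
pose z l m := if l \in E then \sum_j nu j l * y m j else 0.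
have bz l m : bounded c (D %/ p + N) (z l m).
  rewrite /z; case: ifP => _; last by constructor.
  apply: bounded_sum => j _; rewrite addnC; apply: bounded_mul.
    exact: (bnu (j, l)).
  exact: (yP m).1.
exists z; split=> // x polyx.
pose Z l := \sum_m x m * z l m.
have polyZ l : in_subring c (Z l).
  have [Dx bx] := in_subring_family polyx.
  exists (Dx + (D %/ p + N))%N; apply: bounded_sum => m _.
  exact: bounded_mul.
have key : h ^+ p * (\sum_m x m ^+ p * u m) = \sum_(l in E) f l * Z l ^+ p.
  under [RHS]eq_bigr => l lE do
    [rewrite (exprp_sum charF) mulr_sumr; under eq_bigr => m _ do
       rewrite /z lE exprMn (exprp_sum charF) !mulr_sumr].
  rewrite exchange_big mulr_sumr; apply: eq_bigr => m _ /=.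
  rewrite (yP m).2 exchange_big !mulr_sumr; apply: eq_bigr => j _ /=.
  rewrite (mulrCA (x m ^+ p)) [LHS]mulrA span mulr_suml; apply: eq_bigr => l _.
  by rewrite exprMn -!mulrA (mulrCA (x m ^+ p)).
split=> [sum0 l|Z0].
  have [lE|/negPf lE] := boolP (l \in E).
    by apply: (indep Z polyZ) lE; rewrite -key sum0 mulr0.
  by rewrite big1 // => m _; rewrite /z lE mulr0.
apply/eqP; have /eqP: h ^+ p * (\sum_m x m ^+ p * u m) = 0.
  by rewrite key big1 // => l _; rewrite [Z l]Z0 (expr0p charF) mulr0.
by rewrite mulf_eq0 expf_eq0 (negPf h0) andbF.
Qed.

End Descent.

Section FiniteClosure.

Variables (F : fieldType) (p : nat) (charF : p \in [pchar F]).
Variables (S B I : finType).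
Variables (rho : seq S -> B -> F) (M : S -> B -> B -> F) (W : I -> B -> F).
Hypothesis rho_rcons : forall w r m',
  rho (rcons w r) m' = \sum_m rho w m ^+ p * M r m m'.

(** The vectors [v q] are all the vectors of degree at most [2 * N + 1] in the
    finitely many scalars that occur in the data. One step multiplies such a
    vector by a matrix of generators, which gives degree [2 * N + 2], and the
    descent brings this back to [(2 * N + 2) / 2 + N] at most. *)
Lemma finite_frobenius_closure : exists (Q : finType) (v : Q -> B -> F),
  (forall i, exists X : {set Q}, forall w,
     \sum_m rho w m ^+ p * W i m = 0 <->
     forall q, q \in X -> \sum_m rho w m * v q m = 0) /\
  (forall q r, exists X : {set Q}, forall w,
     \sum_m rho (rcons w r) m * v q m = 0 <->
     forall q', q' \in X -> \sum_m rho w m * v q' m = 0).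
Proof.
pose c (x : B + (S * B * B) + (I * B)) := match x with
  | inl (inl m) => rho [::] m
  | inl (inr x) => M x.1.1 x.1.2 x.2
  | inr y => W y.1 y.2
  end.
have bM r m m' : bounded c 1 (M r m m').
  exact: (bounded_generator c (inl (inr (r, m, m')))).
have bW i m : bounded c 1 (W i m) by exact: (bounded_generator c (inr (i, m))).
have poly_rho w m : in_subring c (rho w m).
  elim/last_ind: w m => [|w r IHw] m.
    by exists 1%N; apply: (bounded_generator c (inl (inl m))).
  have {IHw} [D bw] := in_subring_family IHw.
  exists (p * D + 1)%N; rewrite rho_rcons; apply: bounded_sum => m' _.
  by apply: bounded_mul => //; apply: bounded_exp.
have p_gt1 := prime_gt1 (pcharf_prime charF).
have [N descent] := frobenius_descent charF c.
pose D := (N + N).+1.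
have [s sP] := bounded_finite charF c D.
pose Q := {ffun B -> seq_sub s}.
have step (u : B -> F) : (forall m, bounded c D.+1 (u m)) ->
    exists X : {set Q}, forall w, \sum_m rho w m ^+ p * u m = 0 <->
      forall q, q \in X -> \sum_m rho w m * val (q m) = 0.
  move=> /descent[z [bz zP]].
  have leD : (D.+1 %/ p + N <= D)%N.
    rewrite {2}/D -addSn leq_add2r.
    have ->: D.+1 = (N.+1 * 2)%N by rewrite muln2 -addnn addnS.
    by rewrite (leq_trans (leq_div2l _ (ltn0Sn 1) p_gt1)) // mulnK.
  have zs l m : z l m \in s by apply/sP; apply: bounded_le leD (bz l m).
  pose q l : Q := [ffun m => SeqSub (zs l m)].
  exists [set q l | l in setT] => w; rewrite zP //.
  split=> [z0 _ /imsetP[l _ ->]|z0 l].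
    by under eq_bigr => m _ do rewrite ffunE /=; apply: z0.
  have := z0 (q l) (imset_f _ (in_setT l)).
  by under eq_bigr => m _ do rewrite ffunE /=.
exists Q, (fun (q : Q) m => val (q m)); split=> [i|q r].
  by apply: step => m; apply: bounded_le (bW i m).
have [|X XP] := step (fun m => \sum_m' M r m m' * val (q m')).
  move=> m; apply: bounded_sum => m' _; rewrite -add1n.
  by apply: bounded_mul => //; apply/sP/ssvalP.
exists X => w; rewrite -XP.
under eq_bigr => m' _ do rewrite rho_rcons mulr_suml.
rewrite exchange_big /=.
under eq_bigr => m _ do
  [under eq_bigr => m' _ do rewrite -mulrA; rewrite -mulr_sumr].
by [].
Qed.

End FiniteClosure.

(** * Words and tuples of integers *)

Section Words.

Variables (p : nat) (p_pr : prime p) (t : nat).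

Implicit Types (n : {ffun 'I_t -> nat}) (c : letter p t) (w : seq (letter p t)).

Let p_gt0 : (0 < p)%N := prime_gt0 p_pr.

Definition zero : {ffun 'I_t -> nat} := [ffun=> 0%N].

(** The tuple whose least significant letter is [c] and whose other letters are
    those of [n]. *)
Definition push n c : {ffun 'I_t -> nat} := [ffun k => p * n k + c k]%N.

Definition value w : {ffun 'I_t -> nat} := foldl push zero w.

Lemma value_rcons w c : value (rcons w c) = push (value w) c.
Proof. by rewrite /value foldl_rcons. Qed.

Lemma push_divn n c k : (push n c k %/ p = n k)%N.
Proof. by rewrite ffunE mulnC divnMDl // divn_small ?addn0. Qed.

Lemma push_letter_at n : n = push [ffun k => n k %/ p]%N (letter_at p_pr n 0).
Proof.
by apply/ffunP => k; rewrite !ffunE /= expn0 divn1 mulnC -divn_eq.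
Qed.

Lemma top_digit_leP n l :
  reflect (forall k, n k < p ^ l.+1)%N (top_digit p_pr n <= l)%N.
Proof.
rewrite /top_digit; case: ex_minnP => T /forallP nT minT.
apply: (iffP idP) => [leT k|nl]; last by apply: minT; apply/forallP.
by apply: leq_trans (nT k) _; rewrite leq_exp2l // prime_gt1.
Qed.

Lemma top_digit_push n c :
  top_digit p_pr (push n c) = if n == zero then 0%N else (top_digit p_pr n).+1.
Proof.
have le0 : (top_digit p_pr (push n c) <= 0)%N = (n == zero).
  apply/top_digit_leP/eqP => [small|-> k]; last first.
    by rewrite !ffunE muln0 expn1 ltn_ord.
  apply/ffunP => k; rewrite ffunE -(push_divn n c k).
  by rewrite divn_small // -[X in (_ < X)%N]expn1.
have leS l : (top_digit p_pr (push n c) <= l.+1)%N = (top_digit p_pr n <= l)%N.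
  apply/top_digit_leP/top_digit_leP => small k.
    by rewrite -(push_divn n c k) ltn_divLR // -expnSr.
  by rewrite expnSr -ltn_divLR // push_divn.
case: eqP le0 => [_|n0]; first by rewrite leqn0 => /eqP.
case: (top_digit p_pr (push n c)) leS => [leS|T leS _]; first by rewrite leqnn.
by congr _.+1; apply/eqP; rewrite eqn_leq -ltnS leS leqnn -leS leqnn.
Qed.

Lemma letter_at_push0 n c : letter_at p_pr (push n c) 0 = c.
Proof.
apply/ffunP => k; apply: val_inj; rewrite !ffunE /= expn0 divn1.
by rewrite mulnC modnMDl modn_small.
Qed.

Lemma letter_at_pushS n c l :
  letter_at p_pr (push n c) l.+1 = letter_at p_pr n l.
Proof.
apply/ffunP => k; apply: val_inj; rewrite !ffunE [LHS]/= expnS divnMA.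
by rewrite -[in RHS](push_divn n c k) ffunE.
Qed.

Lemma word_of_push n c :
  word_of p_pr (push n c) =
    if n == zero then [:: c] else rcons (word_of p_pr n) c.
Proof.
rewrite /word_of top_digit_push; case: eqP => _.
  by rewrite /= letter_at_push0.
have iotaS l : iota 0 l.+1 = 0%N :: map S (iota 0 l) by rewrite -(iotaDl 1).
rewrite iotaS rev_cons map_rcons letter_at_push0 -map_rev -map_comp.
congr rcons; apply: eq_map => l /=.
exact: letter_at_pushS.
Qed.

Lemma word_ofK n : value (word_of p_pr n) = n.
Proof.
have [K leK] : exists K, forall k, (n k <= K)%N.
  by exists (\max_k n k)%N => k; apply: leq_bigmax.
elim: K n leK => [|K IHK] n leK; rewrite (push_letter_at n) word_of_push.
  have ->: [ffun k => n k %/ p]%N = zero; last by rewrite eqxx.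
  apply/ffunP => k; have := leK k.
  by rewrite !ffunE leqn0 => /eqP->; rewrite div0n.
case: eqP => [->|_] //.
rewrite value_rcons IHK // => k; rewrite ffunE.
have [->|n_gt0] := posnP (n k); first by rewrite div0n.
by rewrite -ltnS (leq_trans _ (leK k)) // ltn_Pdiv // prime_gt1.
Qed.

(** The words with no superfluous leading zero letter, the empty word included:
    this is what must precede the last letter in the word of a tuple. *)
Definition reduced w :=
  w = [::] \/ value w <> zero /\ word_of p_pr (value w) = w.

(** The word of a tuple is never empty, and it starts with the zero letter only
    if this is its single letter; hence the last letter is unrestricted. *)
Lemma reduced_word w c :
  word_of p_pr (value (rcons w c)) = rcons w c <-> reduced w.
Proof.
rewrite value_rcons word_of_push /reduced; case: eqP => [w0|w0].
  split=> [|[->|[]]] //; case: w {w0} => [|b w]; [by left|].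
  by case=> _ /(congr1 size); rewrite size_rcons.
split=> [/rcons_inj[->]|[w_nil|[_ ->]]] //; first by right.
by rewrite w_nil in w0.
Qed.

Lemma push_eq0 n c : push n c = zero <-> n = zero /\ push zero c = zero.
Proof.
split=> [nc0|[->]] //.
have n0 : n = zero.
  by apply/ffunP => k; rewrite -(push_divn n c k) nc0 !ffunE div0n.
by split=> //; rewrite -[RHS]nc0 n0.
Qed.

Lemma reduced_rcons w c :
  reduced (rcons w c) <->
  reduced w /\ (push zero c = zero -> w <> [::]).
Proof.
split=> [[/(congr1 size)|[v0 /reduced_word rw]]|[rw c0]].
- by rewrite size_rcons.
- by split=> // c0 w_nil; apply: v0; rewrite w_nil.
right; split; last exact/reduced_word.
rewrite value_rcons => /push_eq0[v0 /c0].
by case: rw => [//|[]].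
Qed.

End Words.

(** * Powers with exponents split at the last digit *)

Section Powers.

Variables (F : fieldType) (p : nat) (charF : p \in [pchar F]).
Variables (chi : {poly F}) (chi_neq0 : chi != 0).

Definition power_coef (n m : nat) : F := ('X^n %% chi)`_m.

Lemma modXnE n : 'X^n %% chi = \sum_(m < size chi) power_coef n m *: 'X^m.
Proof.
rewrite -poly_def; apply/polyP => m; rewrite coef_poly; case: ltnP => // lem.
by rewrite nth_default // (leq_trans _ lem) // ltnW // ltn_modp.
Qed.

(** The p-th power of the congruence between X^n and its remainder modulo
    [chi], multiplied by X^r. *)
Lemma dvdp_frobenius n r :
  chi %| 'X^(p * n + r) -
         \sum_(m < size chi) power_coef n m ^+ p *: 'X^(p * m + r).
Proof.
have charX : p \in [pchar {poly F}] by rewrite pchar_poly.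
have ->: \sum_(m < size chi) power_coef n m ^+ p *: 'X^(p * m + r) =
         ('X^n %% chi) ^+ p * 'X^r.
  rewrite modXnE (exprp_sum charX) mulr_suml; apply: eq_bigr => m _.
  by rewrite exprZn -exprM -scalerAl -exprD mulnC.
rewrite mulnC exprD exprM -mulrBl dvdp_mulr // -!(pFrobenius_autE charX).
rewrite -rmorphB /= pFrobenius_autE {1}(divp_eq 'X^n chi) addrK.
by rewrite dvdp_exp ?prime_gt0 ?(pcharf_prime charF) // dvdp_mull.
Qed.

Lemma power_coef_frobenius n r m' :
  power_coef (p * n + r) m' =
  \sum_(m < size chi) power_coef n m ^+ p * power_coef (p * m + r) m'.
Proof.
have := dvdp_frobenius n r; rewrite /dvdp modpD modpN subr_eq0 => /eqP.
rewrite /power_coef => ->.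
rewrite (big_morph (fun u : {poly F} => u %% chi) (modpD chi) (mod0p chi)).
rewrite coef_sum.
by apply: eq_bigr => m _; rewrite modpZl coefZ.
Qed.

Lemma mxpower_frobenius d (a : 'M[F]_d.+1) n r :
  horner_mx a chi = 0 ->
  a ^+ (p * n + r) =
  \sum_(m < size chi) power_coef n m ^+ p *: a ^+ (p * m + r).
Proof.
move=> chi_a; apply/eqP; rewrite -subr_eq0; apply/eqP.
have /dvdpP[q /(congr1 (horner_mx a))] := dvdp_frobenius n r.
rewrite rmorphM /= chi_a mulr0 => eq0; rewrite -[RHS]eq0.
rewrite rmorphB rmorphXn /= horner_mx_X rmorph_sum; congr (_ - _).
by apply: eq_bigr => m _; rewrite /= linearZ /= rmorphXn /= horner_mx_X.
Qed.

End Powers.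

(** * The system split at the last digit *)

Section SystemDigits.

Variables (p : nat) (F : fieldType) (charF : p \in [pchar F]).
Variables (chi : {poly F}) (chi_neq0 : chi != 0) (t : nat).

Implicit Type n : {ffun 'I_t -> nat}.

Notation box := {ffun 'I_t -> 'I_(size chi)}.

Definition tensor_coef n (m : box) : F := \prod_k power_coef chi (n k) (m k).

Definition box_val (m : box) : {ffun 'I_t -> nat} := [ffun k => m k : nat].

Lemma tensor_coef_push n (c : letter p t) m' :
  tensor_coef (push n c) m' =
  \sum_m tensor_coef n m ^+ p * tensor_coef (push (box_val m) c) m'.
Proof.
rewrite /tensor_coef.
under eq_bigr => k _ do rewrite ffunE power_coef_frobenius //.
rewrite bigA_distr_bigA; apply: eq_bigr => m _ /=.
by rewrite -prodrXl -big_split; apply: eq_bigr => k _; rewrite /= !ffunE.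
Qed.

(** The tuples of exponents [m] range over a box that does not depend on [n]:
    only the scalars keep track of [n], and they appear as p-th powers. *)
Lemma exp_monomial_push d s q (b : 'I_s -> 'I_q -> 'I_t.+1 -> 'M[F]_d.+1)
    (a : 'I_s -> 'I_q -> 'I_t -> 'M[F]_d.+1) i j n (c : letter p t) :
  (forall k, horner_mx (a i j k) chi = 0) ->
  exp_monomial b a i j (push n c) =
  \sum_m tensor_coef n m ^+ p *: exp_monomial b a i j (push (box_val m) c).
Proof.
move=> chi_a; rewrite /exp_monomial.
under eq_bigr => k _ do
  rewrite ffunE (mxpower_frobenius charF chi_neq0 _ _ (chi_a k)) mulr_suml.
rewrite bigA_distr_bigA mulr_sumr; apply: eq_bigr => m _ /=.
under eq_bigr => k _ do rewrite -scalerAl.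
rewrite scaler_prod -prodrXl scalerAr; congr (_ * (_ *: _)).
by apply: eq_bigr => k _; rewrite !ffunE.
Qed.

(** An integer polynomial depends on its arguments modulo p only, once its
    values are taken in [F]. *)
Lemma poly_value_push s q (P : 'I_s -> 'I_q -> {mpoly int[t]}) i j n
    (c : letter p t) :
  (poly_value P i j (push n c))%:~R =
  (poly_value P i j (push (zero t) c))%:~R :> F.
Proof.
rewrite /poly_value !mevalE !rmorph_sum; apply: eq_bigr => e _ /=.
rewrite !rmorphM !rmorph_prod; congr (_ * _); apply: eq_bigr => k _ /=.
rewrite !rmorphXn; congr (_ ^+ _) => /=.
by rewrite !ffunE -!pmulrn !natrD natrM (pcharf0 charF) !mul0r muln0.
Qed.

End SystemDigits.

Arguments tensor_coef {F} chi {t} n m.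

Section DigitForms.

Variables (p : nat) (F : fieldType) (charF : p \in [pchar F]).
Variables (chi : {poly F}) (d s t q : nat).
Variable P : 'I_s -> 'I_q -> {mpoly int[t]}.
Variable b : 'I_s -> 'I_q -> 'I_t.+1 -> 'M[F]_d.+1.
Variable a : 'I_s -> 'I_q -> 'I_t -> 'M[F]_d.+1.
Hypothesis chi_neq0 : chi != 0.
Hypothesis chi_a : forall i j k, horner_mx (a i j k) chi = 0.

(** The linear form in the [tensor_coef chi n m ^+ p] whose vanishing is the
    [(y, z)] entry of the [j]-th equation at the tuple [push n c]. *)
Definition digit_form (x : 'I_q * 'I_d.+1 * 'I_d.+1 * letter p t)
    (m : {ffun 'I_t -> 'I_(size chi)}) : F :=
  let: (j, y, z, c) := x in
  (\sum_i (poly_value P i j (push (zero t) c))%:~R *: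
             exp_monomial b a i j (push (box_val m) c)) y z.

Lemma solution_push n (c : letter p t) :
  solution P b a (push n c) <->
  forall x, \sum_m tensor_coef chi n m ^+ p * digit_form (x, c) m = 0.
Proof.
have key j : \sum_l (poly_value P l j (push n c))%:~R *:
                      exp_monomial b a l j (push n c) =
    \sum_m tensor_coef chi n m ^+ p *:
      \sum_l (poly_value P l j (push (zero t) c))%:~R *:
               exp_monomial b a l j (push (box_val m) c).
  under eq_bigr => l _ do
    rewrite (poly_value_push charF)
      (exp_monomial_push charF chi_neq0 _ _ _ (chi_a l j)) scaler_sumr.
  rewrite exchange_big; apply: eq_bigr => m _ /=.
  by rewrite scaler_sumr; apply: eq_bigr => l _; rewrite !scalerA mulrC.
split=> [sol [[j x] y]|sum0 j].
  have /matrixP/(_ x y) := sol j; rewrite key summxE mxE => eq0.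
  rewrite -[RHS]eq0.
  by apply: eq_bigr => m _; rewrite [in RHS]mxE.
apply/matrixP => x y; rewrite key summxE mxE -[RHS](sum0 (j, x, y)).
by apply: eq_bigr => m _; rewrite [in LHS]mxE.
Qed.

End DigitForms.

(** The conditions on words are: being the word of a solution, being reduced,
    being nonempty, and the vanishing of one of the finitely many linear forms
    [v u]. Nonemptiness is needed to express that a zero letter does not come
    first. *)
Lemma regular_solutions (p : nat) (p_pr : prime p)
    (F : fieldType) (charF : p \in [pchar F]) (d s t q : nat)
    (P : 'I_s -> 'I_q -> {mpoly int[t]})
    (b : 'I_s -> 'I_q -> 'I_t.+1 -> 'M[F]_d.+1)
    (a : 'I_s -> 'I_q -> 'I_t -> 'M[F]_d.+1) :
  regular (fun w : seq (letter p t) =>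
             exists2 n, solution P b a n & word_of p_pr n = w).
Proof.
pose chi := \prod_i \prod_j \prod_k char_poly (a i j k).
have chi0 : chi != 0.
  by apply: monic_neq0; do 3!apply: monic_prod => ? _; apply: char_poly_monic.
have chi_a i j k : horner_mx (a i j k) chi = 0.
  rewrite /chi (bigD1 i) // (bigD1 j) // (bigD1 k) //= !rmorphM /=.
  by rewrite Cayley_Hamilton !mul0r.
have solE := solution_push charF P b chi0 chi_a.
pose rho (w : seq (letter p t)) := tensor_coef chi (value w).
have [|Q [v [startP stepP]]] := finite_frobenius_closure charF (rho := rho)
  (M := fun c m m' => tensor_coef chi (push (box_val m) c) m')
  (digit_form (p := p) (chi := chi) P b a).
  by move=> w c m'; rewrite /rho value_rcons tensor_coef_push.
pose L (x : option (bool + Q)) (w : seq (letter p t)) : Prop := match x with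
  | None => exists2 n, solution P b a n & word_of p_pr n = w
  | Some (inl true) => reduced p_pr w
  | Some (inl false) => w <> [::]
  | Some (inr u) => \sum_m rho w m * v u m = 0
  end.
pose accept (x : option (bool + Q)) := match x with
  | Some (inl b) => b
  | Some (inr u) => \sum_m rho [::] m * v u m == 0
  | None => false
  end.
refine (universal_regular (L := L) (accept := accept) _ _ None).
  case=> [[[]|u]|] /=; first by split=> // _; left.
  - by split.
  - by split=> /eqP.
  - split=> // -[n _ /(congr1 size)].
    by rewrite size_map size_rev size_iota.
case=> [[[]|u]|] c.
- exists ([set Some (inl true)] :|:
    if push (zero t) c == zero t then [set Some (inl false)] else set0) => w.
  split=> [/reduced_rcons[rw c0] x|Lx].
    case/setUP=> [/set1P->//|].
    by case: eqP => [/c0 w0 /set1P->|_] //; rewrite inE.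
  apply/reduced_rcons; split.
    by apply: (Lx (Some (inl true))); rewrite !inE.
  by move=> /eqP c0; apply: (Lx (Some (inl false))); rewrite c0 !inE.
- exists set0 => w; split=> [_ x|_ /(congr1 size)]; first by rewrite inE.
  by rewrite size_rcons.
- have [X XP] := stepP u c; exists [set Some (inr q') | q' in X] => w.
  split=> [/XP sum0 _ /imsetP[q' /sum0 ? ->] //|Lx]; apply/XP => q' q'X.
  by apply: (Lx (Some (inr q'))); apply: imset_f.
have /fin_all_exists[X XP] x := startP (x, c).
exists (Some (inl true) |: \bigcup_x [set Some (inr q') | q' in X x]) => w.
split=> [[n sol wn]|Lx].
  have vw : value (rcons w c) = n by rewrite -wn word_ofK.
  have rw : reduced p_pr w by apply/(reduced_word p_pr w c); rewrite vw.
  move=> y /setU1P[->//|/bigcupP[x _ /imsetP[q' q'X ->]]] /=.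
  apply: (XP x w).1 q' q'X; apply/(solE (value w) c).1.
  by rewrite -value_rcons vw.
exists (value (rcons w c)).
  rewrite value_rcons; apply/solE => x; apply/XP => q' q'X.
  apply: (Lx (Some (inr q'))); apply/setU1P; right.
  by apply/bigcupP; exists x => //; apply: imset_f.
by apply/reduced_word; apply: (Lx (Some (inl true))); rewrite setU11.
Qed.

Theorem theorem1 (p : nat) (p_pr : prime p)
    (F : fieldType) (charF : p \in [pchar F])
    (d s t m : nat)
    (d_gt0 : (0 < d)%N) (s_gt0 : (0 < s)%N)
    (t_gt0 : (0 < t)%N) (m_gt0 : (0 < m)%N)
    (P : 'I_s -> 'I_m -> {mpoly int[t]})
    (b : 'I_s -> 'I_m -> 'I_t.+1 -> 'M[F]_d)
    (a : 'I_s -> 'I_m -> 'I_t -> 'M[F]_d) :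
  regular (fun w : seq (letter p t) =>
             exists2 n, solution P b a n & word_of p_pr n = w)
  /\
  exists A : automaton (letter p t),
    (forall n, solution P b a n -> readable A (word_of p_pr n))
    /\ (forall w, readable A w ->
          exists! n, solution P b a n /\ word_of p_pr n = w).
Proof.
have reg : regular (fun w : seq (letter p t) =>
             exists2 n, solution P b a n & word_of p_pr n = w).
  by case: d d_gt0 b a => // d' _ b a; apply: regular_solutions.
split=> //; have [A AP] := reg; exists A; split=> [n sol|w /AP[n sol wn]].
  by apply/AP; exists n.
by exists n; split=> // n' [_ wn']; rewrite -(word_ofK p_pr n) wn -wn' word_ofK.
Qed.
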